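(* Let $p$ be a prime. For every rational number $\alpha\in\mathbb{Q}\subset\mathbb{Q}_p$ and each of Algorithms A, B and C, the continued fraction expansion of $\alpha$ obtained by that algorithm is finite.
   Context: Let $p$ be a prime, $v_p$ the $p$-adic additive valuation and $|\alpha|_p = p^{-v_p(\alpha)}$. Each $\alpha\in\mathbb{Q}_p$ has a unique $p$-adic expansion $\alpha=\sum_{i} e_i p^i$ with $e_i\in\{0,1,\dots,p-1\}$ and $e_i\ne 0$ for at most finitely many $i\le 0$; put $[\alpha]=\sum_{i\le 0} e_i p^i$ and $\langle\alpha\rangle=\sum_{i\ge 1}e_ip^i$, so $\alpha=[\alpha]+\langle\alpha\rangle$. Let $A_p$ be the set of elements of $p\mathbb{Z}_p$ that are algebraic over $\mathbb{Q}$ of degree at most two. The minimal polynomial of an algebraic element is its integral polynomial of lowest degree with positive leading coefficient and coprime coefficients. For $x\in A_p$ write it as $aX^2+bX+c$ if $x$ is quadratic and as $bX+c$ if $x$ is rational. For $x\in A_p\setminus\{0\}$ put $u(x)=c|c|_p\in\mathbb{Z}\setminus p\mathbb{Z}$, and define maps $T_1,T_2:A_p\setminus\{0\}\to A_p$ by $$T_1(x)=\frac{u(x)p^{v_p(x)}}{x}-d_1(x),\qquad T_2(x)=\frac{-u(x)p^{v_p(x)}}{x}-d_2(x),$$ where $d_1(x),d_2(x)\in\{1,\dots,p-1\}$ are the unique choices making $T_1(x),T_2(x)\in p\mathbb{Z}_p$. The three algorithms are given by the following maps $T:A_p\setminus\{0\}\to A_p$ (where the minimal polynomial of $x$ is $aX^2+bX+c$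 if $x$ is quadratic and $bX+c$ if $x$ is rational). Algorithm A: $T(x)=T_2(x)$. Algorithm B: $T(x)=T_2(x)$ if $b\ge 0$, and $T(x)=T_1(x)$ if $b<0$. Algorithm C: $T(x)=T_2(x)$ if $b\ge 0$ and $c>0$, and $T(x)=T_1(x)$ otherwise. For a given algorithm put $t(x)=u(x)$, $d(x)=d_1(x)$ when $T(x)$ is defined as $T_1(x)$, and $t(x)=-u(x)$, $d(x)=d_2(x)$ when $T(x)$ is defined as $T_2(x)$; thus $T(x)=t(x)p^{v_p(x)}/x-d(x)$. The expansion of $\alpha\in\mathbb{Q}_p$ (algebraic of degree at most two) by the algorithm is the continued fraction $$[\alpha]+\cfrac{t_1p^{k_1}}{d_1+\cfrac{t_2p^{k_2}}{d_2+\cfrac{t_3p^{k_3}}{\ddots}}},\qquad t_i=t(T^{i-1}(\langle\alpha\rangle)),\ k_i=v_p(T^{i-1}(\langle\alpha\rangle)),\ d_i=d(T^{i-1}(\langle\alpha\rangle)),$$ which terminates after the $N$-th term if $T^N(\langle\alpha\rangle)=0$ for some (first) $N\ge 0$ (for $N=0$, i.e. $\langle\alpha\rangle=0$, it is just $[\alpha]$), and is infinite otherwise. The expansion is finite if such an $N$ exists. *)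

(* Defs.v *)
From HB Require Import structures.
From mathcomp Require Import all_boot all_order all_algebra.
From mathcomp Require Import boolp classical_sets functions cardinality fsbigop.

Set Implicit Arguments.
Unset Strict Implicit.
Unset Printing Implicit Defensive.

Import Order.TTheory GRing.Theory Num.Theory.

Local Open Scope ring_scope.

(* The p-adic integers, as the inverse limit of the rings Z/p^n: the n-th     *)
(* component is the canonical residue in [0, p^n[ (the coherence condition    *)
(* alone forces this range).  The primality proof is a parameter of the type  *)
(* so that the integral domain structure can be inferred.                     *)
Record padic_int (p : nat) (p_pr : prime p) := PadicInt {
  residue :> nat -> int;
  residueP : forall n, residue n = (residue n.+1 %% (p ^ n)%N)%Z }.

Section PadicInt.
Variables (p : nat) (p_pr : prime p).
Local Notation Zp := (padic_int p_pr).

HB.instance Definition _ := gen_eqMixin Zp.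
HB.instance Definition _ := gen_choiceMixin Zp.

Lemma padic_intP (x y : Zp) : (forall n, x n = y n) -> x = y.
Proof.
case: x y => [x xP] [y yP] /= /funext exy.
by rewrite exy in xP *; congr PadicInt; apply: Prop_irrelevance.
Qed.

Fact modz_exp (m : int) n k :
  ((m %% (p ^ (n + k))%N)%Z %% (p ^ n)%N)%Z = (m %% (p ^ n)%N)%Z.
Proof.
apply/eqP; rewrite eqz_mod_dvd {2}(divz_eq m (p ^ (n + k))%N).
by rewrite opprD addrCA subrr addr0 rpredN expnD PoszM mulrCA dvdz_mulr.
Qed.

Lemma residue_mod (x : Zp) n : (x n %% (p ^ n)%N)%Z = x n.
Proof. by rewrite {1}residueP modz_mod -residueP. Qed.

Lemma residue_addn (x : Zp) n k : (x (n + k)%N %% (p ^ n)%N)%Z = x n.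
Proof.
elim: k => [|k IHk]; first by rewrite addn0 residue_mod.
by rewrite -[RHS]IHk addnS [x (n + k)%N]residueP modz_exp.
Qed.

Fact coherent_mod (f : nat -> int) :
  (forall n, (p ^ n)%:Z %| f n.+1 - f n)%Z ->
  forall n, (f n %% (p ^ n)%N)%Z =
            ((f n.+1 %% (p ^ n.+1)%N)%Z %% (p ^ n)%N)%Z.
Proof.
move=> fP n; rewrite -addn1 modz_exp addn1.
by apply/eqP; rewrite eq_sym eqz_mod_dvd.
Qed.

Fact residue_dvd (x : Zp) n : ((p ^ n)%:Z %| x n.+1 - x n)%Z.
Proof. by rewrite -eqz_mod_dvd residue_mod -residueP. Qed.

Fact const_coherent (m : int) n : ((p ^ n)%:Z %| m - m)%Z.
Proof. by rewrite subrr dvdz0. Qed.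

Fact opp_coherent (x : Zp) n : ((p ^ n)%:Z %| - x n.+1 - - x n)%Z.
Proof. by rewrite -opprD rpredN residue_dvd. Qed.

Fact add_coherent (x y : Zp) n :
  ((p ^ n)%:Z %| (x n.+1 + y n.+1) - (x n + y n))%Z.
Proof. by rewrite opprD addrACA rpredD ?residue_dvd. Qed.

Fact mul_coherent (x y : Zp) n : ((p ^ n)%:Z %| x n.+1 * y n.+1 - x n * y n)%Z.
Proof.
rewrite -(subrKA (x n * y n.+1)) -mulrBl -mulrBr.
by apply: rpredD; [apply: dvdz_mulr | apply: dvdz_mull]; apply: residue_dvd.
Qed.

Definition padic_reduce (f : nat -> int)
    (fP : forall n, ((p ^ n)%:Z %| f n.+1 - f n)%Z) : Zp :=
  @PadicInt p p_pr (fun n => f n %% (p ^ n)%N)%Z (coherent_mod fP).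

Definition padic_of_int (m : int) : Zp :=
  padic_reduce (f := fun=> m) (const_coherent m).
Definition padic_opp (x : Zp) : Zp :=
  padic_reduce (f := fun n => - x n) (opp_coherent x).
Definition padic_add (x y : Zp) : Zp :=
  padic_reduce (f := fun n => x n + y n) (add_coherent x y).
Definition padic_mul (x y : Zp) : Zp :=
  padic_reduce (f := fun n => x n * y n) (mul_coherent x y).

Fact padic_addA : associative padic_add.
Proof. by move=> x y z; apply: padic_intP => n /=; rewrite modzDmr modzDml addrA. Qed.

Fact padic_addC : commutative padic_add.
Proof. by move=> x y; apply: padic_intP => n /=; rewrite addrC. Qed.

Fact padic_add0 : left_id (padic_of_int 0) padic_add.
Proof. by move=> x; apply: padic_intP => n /=; rewrite modzDml add0r residue_mod. Qed.

Fact padic_addN : left_inverse (padic_of_int 0) padic_opp padic_add.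
Proof. by move=> x; apply: padic_intP => n /=; rewrite modzDml addNr. Qed.

HB.instance Definition _ :=
  GRing.isZmodule.Build Zp padic_addA padic_addC padic_add0 padic_addN.

Fact padic_mulA : associative padic_mul.
Proof. by move=> x y z; apply: padic_intP => n /=; rewrite modzMmr modzMml mulrA. Qed.

Fact padic_mulC : commutative padic_mul.
Proof. by move=> x y; apply: padic_intP => n /=; rewrite mulrC. Qed.

Fact padic_mul1 : left_id (padic_of_int 1) padic_mul.
Proof. by move=> x; apply: padic_intP => n /=; rewrite modzMml mul1r residue_mod. Qed.

Fact padic_mulDl : left_distributive padic_mul padic_add.
Proof.
by move=> x y z; apply: padic_intP => n /=; rewrite modzMml modzDml modzDmr mulrDl.
Qed.

Fact padic_1neq0 : padic_of_int 1 != 0.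
Proof.
apply/eqP => /(congr1 (fun x : Zp => x 1%N)) /eqP /=.
by rewrite expn1 mod0z modz_small //= ltz_nat prime_gt1.
Qed.

HB.instance Definition _ := GRing.Zmodule_isComNzRing.Build Zp
  padic_mulA padic_mulC padic_mul1 padic_mulDl padic_1neq0.

Definition padic_unit : pred Zp := fun x => `[< exists y, y * x = 1 >].
Definition padic_inv (x : Zp) : Zp :=
  if padic_unit x then xget x [set y | y * x = 1]%classic else x.

Fact padic_mulV : {in padic_unit, left_inverse 1 padic_inv *%R}.
Proof.
move=> x ux; rewrite /padic_inv (ux : padic_unit x).
by case: xgetP => [y _ //|noy]; case/asboolP: ux => y /noy.
Qed.

Fact padic_unitP (x y : Zp) : y * x = 1 -> padic_unit x.
Proof. by move=> yx1; apply/asboolP; exists y. Qed.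

Fact padic_inv_out : {in [predC padic_unit], padic_inv =1 id}.
Proof. by move=> x; rewrite /padic_inv; case: ifP => // ux /negP[].  Qed.

HB.instance Definition _ := GRing.ComNzRing_hasMulInverse.Build Zp
  padic_mulV padic_unitP padic_inv_out.

Lemma residueM (x y : Zp) n : (x * y) n = (x n * y n %% (p ^ n)%N)%Z.
Proof. by []. Qed.

Fact residue_neq0 (x : Zp) n k : x n != 0 -> ~~ ((p ^ n)%:Z %| x (n + k)%N)%Z.
Proof. by apply: contra => /dvdz_mod0P; rewrite residue_addn => ->. Qed.

Fact padic_idomain (x y : Zp) : x * y = 0 -> (x == 0) || (y == 0).
Proof.
move=> xy0; apply/norP => -[/eqP x0 /eqP y0].
have nz (z : Zp) : z <> 0 -> exists n, z n != 0.
  move=> z0; apply: contra_notP z0 => /forallNP zn.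
  by apply: padic_intP => n; have /negP/negPn/eqP -> := zn n; rewrite /= mod0z.
have [n xn] := nz _ x0; have [m ym] := nz _ y0.
have := residue_neq0 m xn; have := residue_neq0 n ym; rewrite [(m + n)%N]addnC.
have : ((p ^ (n + m))%:Z %| x (n + m)%N * y (n + m)%N)%Z.
  by apply/dvdz_mod0P; rewrite -residueM xy0 /= mod0z.
rewrite !dvdzE abszM /=; move: `|x _|%N `|y _|%N => a b.
have [->|a0] := posnP a; first by rewrite dvdn0.
have [->|b0] := posnP b; first by rewrite dvdn0.
rewrite !pfactor_dvdn ?muln_gt0 ?a0 // lognM // -!ltnNge => nm lb la.
by have := leq_ltn_trans nm (leq_add la (ltnW lb)); rewrite ltnn.
Qed.

HB.instance Definition _ :=
  GRing.ComUnitRing_isIntegral.Build Zp padic_idomain.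

End PadicInt.

Definition padic (p : nat) (p_pr : prime p) := {fraction (padic_int p_pr)}.
HB.instance Definition _ p p_pr := GRing.Field.on (@padic p p_pr).

Section ContinuedFraction.
Variables (p : nat) (p_pr : prime p).
Local Notation Zp := (padic_int p_pr).
Local Notation Qp := (padic p_pr).
Local Open Scope classical_set_scope.

Definition in_pnZp (n : nat) (x : Qp) : Prop :=
  exists z : Zp, x = p%:R ^+ n * tofrac z.

(* 0 at x = 0, where the mathematical value is +oo *)
Definition vp (x : Qp) : int :=
  xget 0 [set k : int | exists2 z : Zp, z \is a GRing.unit & x = p%:R ^ k * tofrac z].

Definition digit_sum (e : int -> nat) (m : int) : Qp :=
  \sum_(i \in [set i : int | i <= m]) ((e i)%:R * p%:R ^ i : Qp).

(* The family e is a p-adic expansion of x: the partial sums, which are       *)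
(* finite sums because finitely many digits are nonzero at indices <= 0,      *)
(* converge to x.                                                             *)
Definition is_expansion (x : Qp) (e : int -> nat) : Prop :=
  [/\ forall i, (e i < p)%N,
      finite_set [set i : int | i <= 0 /\ e i <> 0%N]
    & forall N : nat, exists M : nat, forall n : nat, (M <= n)%N ->
        in_pnZp N (x - digit_sum e n%:Z)].

Definition digits (x : Qp) : int -> nat :=
  xget (fun=> 0%N) [set e | is_expansion x e].

(* [x] *)
Definition padic_floor (x : Qp) : Qp := digit_sum (digits x) 0.

(* <x>; it is the sum of the expansion over the indices i >= 1 *)
Definition padic_frac (x : Qp) : Qp := x - padic_floor x.

Definition is_minpoly (x : Qp) (f : {poly int}) : Prop :=
  [/\ root (map_poly intr f) x,
      0 < lead_coef f,
      zcontents f = 1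
    & forall g : {poly int}, g != 0 -> root (map_poly intr g) x ->
        (size f <= size g)%N].

Definition minpoly (x : Qp) : {poly int} := xget 0 [set f | is_minpoly x f].

(* A_p; the maps below are only meaningful, and only used, on A_p \ {0},      *)
(* where every xget below picks an existing element.                          *)
Definition Ap (x : Qp) : Prop :=
  in_pnZp 1 x /\
  exists f : {poly int}, [/\ f != 0, (size f <= 3)%N & root (map_poly intr f) x].

(* Whether x is quadratic or rational, its minimal polynomial being written   *)
(* a X^2 + b X + c or b X + c, b and c are the coefficients of X and 1.       *)
Definition coef_b (x : Qp) : int := (minpoly x)`_1.
Definition coef_c (x : Qp) : int := (minpoly x)`_0.

(* c |c|_p, where |c|_p = p^- (v_p c); the division is exact *)
Definition u (x : Qp) : int :=
  (coef_c x %/ (p ^ logn p `|coef_c x|)%N)%Z.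

(* the d in {1, ..., p-1} such that y - d \in p Z_p, for a unit y of Z_p *)
Definition digit (y : Qp) : nat :=
  xget 0%N [set d : nat | (0 < d < p)%N /\ in_pnZp 1 (y - d%:R)].

Definition d1 (x : Qp) : nat := digit ((u x)%:~R * p%:R ^ vp x / x).
Definition d2 (x : Qp) : nat := digit (- (u x)%:~R * p%:R ^ vp x / x).

Definition T1 (x : Qp) : Qp := (u x)%:~R * p%:R ^ vp x / x - (d1 x)%:R.
Definition T2 (x : Qp) : Qp := - (u x)%:~R * p%:R ^ vp x / x - (d2 x)%:R.

Inductive algorithm := AlgA | AlgB | AlgC.

Definition uses_T2 (A : algorithm) (x : Qp) : bool :=
  match A with
  | AlgA => true
  | AlgB => 0 <= coef_b x
  | AlgC => (0 <= coef_b x) && (0 < coef_c x)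
  end.

Definition T (A : algorithm) (x : Qp) : Qp :=
  if uses_T2 A x then T2 x else T1 x.
Definition t (A : algorithm) (x : Qp) : int :=
  if uses_T2 A x then - u x else u x.
Definition d (A : algorithm) (x : Qp) : nat :=
  if uses_T2 A x then d2 x else d1 x.

(* The formal continued fraction                                              *)
(*   cf_head + t_1 p^k_1 / (d_1 + t_2 p^k_2 / (d_2 + ...));                   *)
(* cf_term n is Some (t_(n+1), k_(n+1), d_(n+1)), or None when the continued  *)
(* fraction has at most n terms.                                              *)
Record continued_fraction := ContinuedFraction {
  cf_head : Qp;
  cf_term : nat -> option (int * int * nat) }.

Definition cf_finite (c : continued_fraction) : Prop :=
  exists N, cf_term c N = None.

Definition cf_expansion (A : algorithm) (x : Qp) : continued_fraction :=
  ContinuedFraction (padic_floor x) (fun n =>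
    let y i := iter i (T A) (padic_frac x) in
    if [forall i : 'I_n.+1, y i != 0]
    then Some (t A (y n), vp (y n), d A (y n)) else None).

End ContinuedFraction.

(* Main.v *)
Require Import Defs.
From mathcomp Require Import all_boot all_order all_algebra.
From mathcomp Require Import boolp classical_sets functions cardinality fsbigop.

(* A nonzero rational x in p Z_p has the minimal polynomial b X - a with b > 0,
   x = a / b and p not dividing b, and u(x) p^(v_p x) = - a.  Hence
   T_1(x) = - b - d_1(x) and T_2(x) = b - d_2(x): one step of any of the
   algorithms leads to an integer.  For an integer, b = 1, so that T_2 gives 0
   and T_1 gives - p; the negative integer - p has b, c > 0, and is therefore
   sent to 0 by T_2 in each of the algorithms. *)

Set Implicit Arguments.
Unset Strict Implicit.
Unset Printing Implicit Defensive.

Import Order.TTheory GRing.Theory Num.Theory.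

Local Open Scope ring_scope.

Section PadicRationals.
Variables (p : nat) (p_pr : prime p).
Local Notation Zp := (padic_int p_pr).
Local Notation Qp := (padic p_pr).

(** * Residues, divisibility by powers of p and units in the p-adic integers *)

Lemma residueD (x y : Zp) n : (x + y) n = ((x n + y n) %% (p ^ n)%N)%Z.
Proof. by []. Qed.

Lemma residueN (x : Zp) n : (- x) n = (- x n %% (p ^ n)%N)%Z.
Proof. by []. Qed.

Lemma residueB (x y : Zp) n : (x - y) n = ((x n - y n) %% (p ^ n)%N)%Z.
Proof. by rewrite residueD residueN modzDmr. Qed.

Lemma residue_intr (m : int) n : (m%:~R : Zp) n = (m %% (p ^ n)%N)%Z.
Proof.
elim: m => [|m IHm|m IHm] //.
  by rewrite -addn1 PoszD rmorphD residueD IHm modzDml modzDmr.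
by rewrite -addn1 PoszD opprD rmorphB residueB IHm modzDml -modzDmr modzNm modzDmr.
Qed.

Lemma residue_natr (m : nat) n : (m%:R : Zp) n = (m%:Z %% (p ^ n)%N)%Z.
Proof. exact: residue_intr m%:Z n. Qed.

Lemma expp_neq0 n : (p ^ n)%:Z != 0.
Proof. by rewrite eqz_nat expn_eq0 negb_and -lt0n prime_gt0. Qed.

(** All later residues of x are divisible by p^n as well, so x can be divided by shifting: the k-th
    residue of the quotient comes from x_(n+k) / p^n. *)
Lemma residue_eq0_dvd (x : Zp) n : x n = 0 -> exists w : Zp, x = p%:R ^+ n * w.
Proof.
move=> xn0.
have dvdx k : ((p ^ n)%:Z %| x (n + k)%N)%Z.
  by apply/dvdz_mod0P; rewrite residue_addn.
have wP k : ((p ^ k)%:Z %| (x (n + k.+1)%N %/ (p ^ n)%N)%Z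
                         - (x (n + k)%N %/ (p ^ n)%N)%Z)%Z.
  rewrite -(dvdz_mul2l (p := (p ^ n)%:Z)) ?expp_neq0 // -PoszM -expnD mulrBr.
  by rewrite !(mulrC (p ^ n)%:Z) !divzK // addnS residue_dvd.
exists (padic_reduce p_pr wP); apply: padic_intP => k.
rewrite -natrX residueM residue_natr /= modzMml modzMmr mulrC divzK //.
by rewrite addnC residue_addn.
Qed.

(** The inverse is assembled from the Bezout coefficients [w n] of m against p^n. *)
Lemma intr_unit (m : int) : ~~ (p %| m)%Z -> (m%:~R : Zp) \is a GRing.unit.
Proof.
move=> pm.
have cop n : coprimez (p ^ n)%N m.
  by rewrite coprimezE /= coprimeXl ?prime_coprime.
pose w n := (egcdz m (p ^ n)%N).1.
have wE n : {v : int | w n * m = 1 - v * (p ^ n)%:Z}.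
  rewrite /w; case: egcdzP => v v' vE _ /=; exists v'.
  by apply: (canRL (addrK _)); rewrite vE gcdzC; apply/eqP/cop.
have wP n : ((p ^ n)%:Z %| w n.+1 - w n)%Z.
  (* As m is prime to p^n, coherence may be checked after multiplying by m, where both terms become
     1 modulo p^n. *)
  rewrite -(Gauss_dvdzr _ (cop n)) mulrBr !(mulrC m).
  have [v ->] := wE n; have [v' ->] := wE n.+1.
  rewrite opprB addrC subrKA rpredB ?dvdz_mull //.
  by rewrite dvdzE /= expnS dvdn_mull.
apply/unitrPr; exists (padic_reduce p_pr wP); apply: padic_intP => n.
rewrite residueM residue_intr /= modzMml modzMmr mulrC.
have [v ->] := wE n; rewrite -mulNr addrC modzMDl.
exact: (esym (residue_intr 1 n)).
Qed.

Lemma pX_mul_nonunit (z : Zp) n : (0 < n)%N -> p%:R ^+ n * z \isn't a GRing.unit.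
Proof.
case: n => // n _; apply/negP => /unitrPr[y /(congr1 (fun z : Zp => z 1%N))].
have -> : (1 : Zp) 1%N = 1.
  by rewrite -[1 in LHS]/(1%:~R) residue_intr modz_small //= ltz_nat expn1 prime_gt1.
by rewrite -mulrA exprS -mulrA residueM residue_natr expn1 modzz mul0r mod0z.
Qed.

(** * Integers in Q_p: divisibility, valuation and digits *)

Lemma in_pnZp_intr n (m : int) :
  in_pnZp n (m%:~R : Qp) <-> ((p ^ n)%:Z %| m)%Z.
Proof.
split=> [[z]|/dvdzP[q ->]].
  rewrite -(rmorph_int (@tofrac Zp)) -(rmorph_nat (@tofrac Zp)) -rmorphXn -rmorphM.
  move/eqP; rewrite tofrac_eq => /eqP /(congr1 (fun z : Zp => z n)).
  rewrite residue_intr -natrX residueM residue_natr modzz mul0r mod0z.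
  by move/dvdz_mod0P.
by exists q%:~R; rewrite rmorph_int rmorphM mulrC -natrX.
Qed.

Lemma intr_padic_inj : injective (fun m : int => m%:~R : Qp).
Proof.
move=> m n /eqP; rewrite -subr_eq0 -rmorphB /= => /eqP mn0.
(* A difference k = |m - n| > 0 that vanishes in Q_p would be divisible by p^k, although k < p^k. *)
apply/eqP; rewrite -subr_eq0 -absz_eq0 -leqn0 leqNgt; apply/negP => mn_gt0.
have /in_pnZp_intr/(dvdn_leq mn_gt0) : in_pnZp `|m - n|%N ((m - n)%:~R : Qp).
  by exists 0; rewrite mn0 rmorph0 mulr0.
by rewrite leqNgt ltn_expl ?prime_gt1.
Qed.

Lemma intr_padic_eq0 (m : int) : ((m%:~R : Qp) == 0) = (m == 0).
Proof. by rewrite -(inj_eq intr_padic_inj). Qed.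

Lemma p_padic_neq0 : (p%:R : Qp) != 0.
Proof. by rewrite (intr_padic_eq0 p) eqz_nat -lt0n prime_gt0. Qed.

Lemma in_pnZpD n (x y : Qp) : in_pnZp n x -> in_pnZp n y -> in_pnZp n (x + y).
Proof. by move=> [z ->] [w ->]; exists (z + w); rewrite rmorphD mulrDr. Qed.

Lemma in_pnZpM n (z : Zp) (x : Qp) : in_pnZp n x -> in_pnZp n (tofrac z * x).
Proof. by move=> [w ->]; exists (z * w); rewrite rmorphM mulrCA. Qed.

Lemma in_pnZp_sum n (I : eqType) (r : seq I) (F : I -> Qp) :
  {in r, forall i, in_pnZp n (F i)} -> in_pnZp n (\sum_(i <- r) F i).
Proof.
move=> rF; rewrite big_seq; elim/big_ind: _ => //; last exact: in_pnZpD.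
by exists 0; rewrite rmorph0 mulr0.
Qed.

(** The exponent is unique: p^i y = p^j w with i < j gives y = p^(j-i) w, which is not a unit. *)
Lemma vp_unit (k : int) (z : Zp) :
  z \is a GRing.unit -> vp (p%:R ^ k * tofrac z : Qp) = k.
Proof.
have le (i j : int) (y w : Zp) : y \is a GRing.unit ->
    (p%:R ^ i * tofrac y : Qp) = p%:R ^ j * tofrac w -> j <= i.
  move=> yU; rewrite leNgt => yw; apply/negP => ij.
  have [n ijE n_gt0] : exists2 n : nat, j = i + n%:Z & (0 < n)%N.
    exists `|j - i|%N; last by rewrite absz_gt0 subr_eq0 gt_eqF.
    by rewrite gez0_abs ?subr_ge0 ?ltW // [RHS]addrC subrK.
  move: yw; rewrite ijE expfzDr ?p_padic_neq0 // -mulrA => /mulfI.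
  rewrite expfz_neq0 ?p_padic_neq0 // => /(_ isT) /eqP.
  rewrite -exprnP -(rmorph_nat (@tofrac Zp)) -rmorphXn -rmorphM tofrac_eq.
  by move=> /eqP yE; move: yU; rewrite yE (negPf (pX_mul_nonunit _ _)).
move=> zU; apply: xget_unique; first by exists z.
move=> j [w wU zw]; apply/le_anti/andP; split.
  exact: le zU zw.
exact: le wU (esym zw).
Qed.

Lemma digit_intr (m : int) : ~~ (p %| m)%Z ->
  digit (m%:~R : Qp) = `|(m %% p)%Z|%N.
Proof.
move=> pm; have p0 : p%:Z != 0 by rewrite eqz_nat -lt0n prime_gt0.
have pE : `|(m %% p)%Z|%N = (m %% p)%Z :> int by rewrite gez0_abs ?modz_ge0.
have dP (d : nat) : in_pnZp 1 ((m%:~R : Qp) - d%:R) <-> (p %| m - d%:Z)%Z.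
  rewrite -[d%:R]/((d%:Z)%:~R) -rmorphB.
  by have := in_pnZp_intr 1 (m - d%:Z); rewrite expn1.
apply: xget_unique => [|d [/andP[d_gt0 dp] /dP]].
  split; last by apply/dP; rewrite pE -eqz_mod_dvd modz_mod.
  rewrite absz_gt0 -ltz_nat pE ltz_pmod ?ltz_nat ?prime_gt0 // andbT.
  by apply: contra pm => /eqP/dvdz_mod0P.
by rewrite -eqz_mod_dvd => /eqP ->; rewrite modz_small // ltz_nat.
Qed.

(** * The minimal polynomial of a rational number *)

(** A competitor g also has degree 1 and root a/b, hence b g = g_1 f for the given polynomial f;
    both are primitive, so comparing contents gives b = g_1 and g = f. *)
Lemma minpoly_ratio (a b : int) : 0 < b -> coprimez a b ->
  minpoly (a%:~R / b%:~R : Qp) = b *: 'X - a%:P.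
Proof.
move=> b_gt0 cab; set x := _ / _; set f : {poly int} := _ - _.
have b0 : (b%:~R : Qp) != 0 by rewrite intr_padic_eq0 gt_eqF.
have f1 : f`_1 = b by rewrite !coefE /= mulr1 subr0.
have f0 : f`_0 = - a by rewrite !coefE /= mulr0 add0r.
have f2 i : f`_i.+2 = 0 by rewrite !coefE /= mulr0 subr0.
have size_le2 (g : {poly int}) : (forall i, g`_i.+2 = 0) -> (size g <= 2)%N.
  by move=> g2; apply/leq_sizeP => -[|[|i]].
have sf : size f = 2%N.
  apply/eqP; rewrite eqn_leq size_le2 //= ltnNge; apply/negP => /leq_sizeP/(_ 1%N isT).
  by rewrite f1 => b_eq0; rewrite b_eq0 in b_gt0.
have lf : lead_coef f = b by rewrite lead_coefE sf.
have fn0 : f != 0 by rewrite -lead_coef_eq0 lf gt_eqF.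
have inj0 : (0 : int)%:~R = 0 :> Qp by [].
have root2 (g : {poly int}) : g != 0 -> root (map_poly intr g) x -> (1 < size g)%N.
  move=> g0; rewrite -(size_map_inj_poly intr_padic_inj inj0).
  by apply: root_size_gt1; rewrite map_poly_eq0_id0 ?intr_padic_eq0 ?lead_coef_eq0.
have rf : root (map_poly intr f) x.
  rewrite rootE rmorphB /= map_polyZ map_polyX map_polyC !hornerE /=.
  by rewrite [_ * a%:~R]mulrC mulfK ?subrr.
have cf : zcontents f = 1.
  have c_gt0 : 0 < zcontents f by rewrite -sgz_gt0 sgz_contents sgz_gt0 lf.
  have /eqP cabN : coprime `|a| `|b| := cab.
  (* The content divides both coefficients -a and b, hence their gcd 1. *)
  apply/eqP; rewrite -[zcontents f]gtz0_abs // eqz_nat -dvdn1 -cabN.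
  have /polyOverP cf : f \is a polyOver (dvdz (zcontents f)) by rewrite -dvdz_contents.
  by rewrite dvdn_gcd -(abszN a) -f0 -f1; apply/andP; split; apply: cf.
apply: xget_unique; first split; rewrite ?lf //.
  by move=> g g0 /root2 - /(_ g0); rewrite sf.
move=> g [rg g_gt0 cg gmin].
have g0 : g != 0 by rewrite -lead_coef_eq0 gt_eqF.
have sg : size g = 2%N.
  apply/eqP; rewrite eqn_leq root2 // andbT.
  by have := gmin f fn0 rf; rewrite sf.
have gab : g`_0 * b + g`_1 * a = 0.
  apply: intr_padic_inj; rewrite /= rmorphD !rmorphM /=.
  move: rg; rewrite rootE horner_coef (size_map_inj_poly intr_padic_inj inj0) sg.
  rewrite !big_ord_recl big_ord0 !coef_map /= expr0 expr1 mulr1 addr0.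
  move=> /eqP/(congr1 ( *%R^~ b%:~R)).
  by rewrite mulrDl mul0r mulrA divfK.
have bg : b *: g = g`_1 *: f.
  apply/polyP => -[|[|i]]; rewrite !coefZ ?f0 ?f1 ?f2; last first.
  - by rewrite nth_default ?sg // !mulr0.
  - exact: mulrC.
  by apply/eqP; rewrite mulrN mulrC -addr_eq0 gab.
move: (congr1 zcontents bg); rewrite !zcontentsZ cg cf !mulr1 => bE.
have bP0 : b%:P != 0 by rewrite polyC_eq0 gt_eqF.
by apply: (mulfI bP0); rewrite !mul_polyC bg bE.
Qed.

(** * Digit sums and existence of p-adic expansions *)

Lemma intr_pX n : ((p ^ n)%N%:~R : Qp) = p%:R ^+ n.
Proof. exact: natrX. Qed.

(** Turns the sum over the infinite set of indices i <= m into a sum over a list that misses only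
    zero digits. *)
Lemma digit_sumE (e : int -> nat) (r : seq int) (m : int) : uniq r ->
    {in r, forall i, i <= m} -> (forall i, i <= m -> i \notin r -> e i = 0%N) ->
  digit_sum p_pr e m = \sum_(i <- r) (e i)%:R * p%:R ^ i.
Proof.
move=> r_uniq rm er; rewrite /digit_sum (fsbigE r) // => [|i im ir].
  by rewrite big_seq_cond [RHS]big_seq_cond; apply: eq_bigl => i;
    case: (boolP (i \in r)) => //= /rm im; rewrite mem_set.
by rewrite er // mul0r.
Qed.

(** The list r collects the indices i <= 0 with nonzero digit. It does not depend on n, so its part
    of the sum is the integral part for every n. *)
Lemma digit_sum_finite (e : int -> nat) :
    finite_set [set i : int | i <= 0 /\ e i <> 0%N]%classic ->
  exists r : seq int, forall n : nat, digit_sum p_pr e n =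
    \sum_(i <- r) (e i)%:R * p%:R ^ i + \sum_(1 <= i < n.+1) (e i)%:R * p%:R ^+ i.
Proof.
case/finite_seqP => s sE; exists (undup s) => n.
have memP i : (i \in s) = `[< i <= 0 /\ e i <> 0%N >].
  have -> : (i \in s) = `[< [set` s]%classic i >] by rewrite /= asboolb.
  by rewrite -sE.
rewrite (digit_sumE (r := undup s ++ [seq i%:Z | i <- iota 1 n])).
- rewrite big_cat big_map /index_iota subn1 /=; congr (_ + _).
- rewrite cat_uniq undup_uniq map_inj_uniq ?iota_uniq ?andbT; last by move=> i j [].
  apply/hasPn => _ /mapP[i + ->]; rewrite mem_iota => /andP[i_gt0 _].
  rewrite /= mem_undup memP; apply/asboolP => -[].
  by rewrite lez_nat leqNgt i_gt0.
- move=> i; rewrite mem_cat mem_undup memP => /orP[/asboolP[i0 _]|].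
    exact: le_trans i0 _.
  by case/mapP => j + ->; rewrite mem_iota add1n ltnS lez_nat => /andP[].
move=> i im; rewrite mem_cat mem_undup memP negb_or => /andP[/asboolPn i0].
have [i_le0|i_gt0] := leP i 0; first by move=> _; apply: contra_notP i0.
case/mapP; exists `|i|%N; last by rewrite gtz0_abs.
by rewrite mem_iota add1n ltnS absz_gt0 gt_eqF //= -lez_nat gtz0_abs.
Qed.

(** The digits of p^(-k) z are those of z, shifted by k places. *)
Lemma is_expansion_exists (z : Zp) (k : nat) :
  exists e, is_expansion (p%:R ^ (- k%:Z) * tofrac z : Qp) e.
Proof.
(* The j-th digit of z is the top base-p digit of z mod p^(j+1). *)
pose dg j := `|(z j.+1 %/ (p ^ j)%N)%Z|%N.
have p_gt0 n : 0 < (p ^ n)%:Z by rewrite ltz_nat expn_gt0 prime_gt0.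
have z_ge0 n : 0 <= z n by rewrite -residue_mod modz_ge0 ?gt_eqF.
have dgE j : (dg j)%:Z = (z j.+1 %/ (p ^ j)%N)%Z.
  by rewrite gez0_abs // divz_ge0.
have zE n : z n = \sum_(j < n) (dg j)%:Z * (p ^ j)%:Z.
  elim: n => [|n IHn]; first by rewrite big_ord0 -residue_mod modz1.
  by rewrite big_ord_recr /= -IHn dgE [z n in RHS]residueP addrC -divz_eq.
pose e (i : int) := if 0 <= i + k%:Z then dg `|(i + k%:Z)%R|%N else 0%N.
have eE (j : nat) : e (j%:Z - k%:Z) = dg j by rewrite /e subrK.
have sumE (n : nat) : digit_sum p_pr e n = p%:R ^ (- k%:Z) * (z (n + k).+1)%:~R.
  rewrite (digit_sumE (r := [seq j%:Z - k%:Z | j <- iota 0 (n + k).+1])).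
  - rewrite big_map -[iota _ _]/(index_iota 0 (n + k).+1) big_mkord.
    rewrite zE rmorph_sum mulr_sumr; apply: eq_bigr => j _.
    rewrite eE rmorphM /= mulrCA.
    rewrite intr_pX expfzDr ?p_padic_neq0 //.
    by rewrite [_ * p%:R ^ (- _)]mulrC.
  - by rewrite map_inj_uniq ?iota_uniq // => i j /addIr[].
  - move=> _ /mapP[j + ->]; rewrite mem_iota add0n ltnS => jn.
    by rewrite lerBlDr -PoszD lez_nat.
  move=> i im /mapP ir; rewrite /e; case: ifP => // ik; case: ir.
  exists `|(i + k%:Z)%R|%N; last by rewrite gez0_abs // addrK.
  by rewrite mem_iota add0n ltnS leq0n -lez_nat gez0_abs // PoszD lerD2r.
exists e; split => [i||N].
- rewrite /e; case: ifP => _; last exact: prime_gt0.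
  rewrite -ltz_nat dgE ltz_divLR // -PoszM -expnS -residue_mod.
  by rewrite ltz_pmod.
- pose r := [seq j%:Z - k%:Z | j <- iota 0 k.+1].
  apply: (@sub_finite_set _ _ [set` r]%classic) => //.
  move=> i [i_le0]; rewrite /e; case: ifP => // ik _; apply/mapP.
  exists `|(i + k%:Z)%R|%N; last by rewrite gez0_abs // addrK.
  by rewrite mem_iota add0n ltnS leq0n -lez_nat gez0_abs // gerDr.
(* The partial sum up to n is p^(-k) z_(n+k+1), so the error is p^(-k) p^(n+k+1) w = p^(n+1) w, a
   multiple of p^N as soon as n >= N. *)
exists N => n Nn; rewrite sumE -mulrBr.
have [w wE] : exists w : Zp, z - (z (n + k).+1)%:~R = p%:R ^+ (n + k).+1 * w.
  by apply: residue_eq0_dvd; rewrite residueB residue_intr residue_mod subrr mod0z.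
exists (p%:R ^+ (n - N).+1 * w).
rewrite -(rmorph_int (@tofrac Zp)) -rmorphB wE !rmorphM !rmorphXn !rmorph_nat.
rewrite !mulrA; congr (_ * _); rewrite -exprD addnS subnKC // -addSn addnC exprD.
by rewrite mulrA -exprnN mulVf ?mul1r // expf_neq0 ?p_padic_neq0.
Qed.

(** * Rational elements of Q_p and their fractional parts *)

Definition is_ratio (x : Qp) :=
  exists a b : int, b != 0 /\ x = a%:~R / b%:~R.

Lemma is_ratioD x y : is_ratio x -> is_ratio y -> is_ratio (x + y).
Proof.
move=> [a [b [b0 ->]]] [c [d [d0 ->]]]; exists (a * d + c * b), (b * d).
by rewrite mulf_neq0 // rmorphD !rmorphM /= addf_div ?intr_padic_eq0.
Qed.

Lemma is_ratioN x : is_ratio x -> is_ratio (- x).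
Proof. by move=> [a [b [b0 ->]]]; exists (- a), b; rewrite rmorphN mulNr. Qed.

Lemma is_ratio_digit (n : nat) (i : int) : is_ratio (n%:R * p%:R ^ i).
Proof.
(* The negative constructor with argument i stands for -(i+1), whence the denominator p^(i+1). *)
case: i => i; [exists (n%:Z * (p ^ i)%N), 1 | exists n, (p ^ i.+1)%N].
  by rewrite divr1 rmorphM /= intr_pX.
by split; [exact: expp_neq0 | rewrite intr_pX NegzE -exprnN].
Qed.

(** The division on the right takes place in Z_p, where b is invertible. *)
Lemma unit_ratio (a b : int) : ~~ (p %| b)%Z ->
  (a%:~R / b%:~R : Qp) = tofrac (a%:~R / b%:~R : Zp).
Proof.
move=> pb; rewrite (rmorphM (@tofrac Zp)) (rmorphV (@tofrac Zp)) ?intr_unit //=.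
by rewrite !rmorph_int.
Qed.

Lemma pfactor_int (b : int) : b != 0 ->
  exists2 b' : int, ~~ (p %| b')%Z & b = b' * (p ^ logn p `|b|)%N.
Proof.
move=> b0; have [|b' pb' bE] := pfactor_coprime p_pr (n := `|b|).
  by rewrite absz_gt0.
exists (Num.sg b * b'%:Z); last by rewrite -mulrA -PoszM -bE -intEsg.
by rewrite dvdzE abszM absz_sg b0 mul1n -prime_coprime.
Qed.

(** The power of p in the denominator becomes the shift; the rest of the denominator is a unit of
    Z_p. *)
Lemma is_ratio_expansion x : is_ratio x -> exists e, is_expansion x e.
Proof.
move=> [a [b [b0 ->]]]; have [b' pb' ->] := pfactor_int b0.
have [e eP] := is_expansion_exists (a%:~R / b'%:~R) (logn p `|b|).
by exists e; rewrite rmorphM /= invfM mulrA mulrC intr_pX unit_ratio // exprnN.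
Qed.

Lemma is_ratio_sum (I : Type) (r : seq I) (F : I -> Qp) :
  (forall i, is_ratio (F i)) -> is_ratio (\sum_(i <- r) F i).
Proof.
move=> rF; elim/big_ind: _ => //; last exact: is_ratioD.
by exists 0, 1; rewrite mul0r.
Qed.

(** The integral part is a finite sum of rational terms. Modulo p Z_p, x agrees with some partial
    sum, whose terms of index at least 1 are multiples of p. *)
Lemma padic_frac_ratio x : is_ratio x ->
  is_ratio (padic_frac x) /\ in_pnZp 1 (padic_frac x).
Proof.
(* An expansion exists for rational x, so [digits x] is a genuine one and not the default value. *)
move=> xq; have [_ efin ex] : is_expansion x (digits x).
  by apply: xgetPex; apply: is_ratio_expansion.
have [r rE] := digit_sum_finite efin; rewrite /padic_frac /padic_floor.
set S := \sum_(i <- r) _ in rE.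
have S0 : digit_sum p_pr (digits x) 0 = S by rewrite (rE 0%N) big_geq ?addr0.
split.
  rewrite S0; apply/is_ratioD/is_ratioN/is_ratio_sum => // i.
  exact: is_ratio_digit.
have [M /(_ M (leqnn M))] := ex 1%N; rewrite rE S0 => xM.
rewrite -[x](subrK (S + \sum_(1 <= i < M.+1) (digits x i)%:R * p%:R ^+ i)) -addrA.
apply: in_pnZpD => //; rewrite addrAC subrr add0r; apply: in_pnZp_sum => i.
rewrite mem_index_iota => /andP[i_gt0 _]; exists ((digits x i)%:R * p%:R ^+ i.-1).
by rewrite rmorphM rmorphXn !rmorph_nat /= mulrCA -exprD add1n prednK.
Qed.

(** Take the reduced fraction. If p divided its denominator, then, x being in p Z_p, p would also
    divide the numerator x b. *)
Lemma in_pZp_ratio x : is_ratio x -> in_pnZp 1 x ->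
  exists a b : int, [/\ x = (a%:~R / b%:~R : Qp), 0 < b, coprimez a b & ~~ (p %| b)%Z].
Proof.
move=> [a [b [b0 xE]]] xp; pose q : rat := a%:~R / b%:~R.
have cop : coprimez (numq q) (denq q) := coprime_num_den q.
have d0 : ((denq q)%:~R : Qp) != 0 by rewrite intr_padic_eq0 denq_neq0.
have qE : numq q * b = a * denq q.
  apply: (@intr_inj rat); rewrite !rmorphM /= numqE /q mulrAC divfK //.
  by rewrite intr_eq0.
have xq : x = (numq q)%:~R / (denq q)%:~R.
  apply/eqP; rewrite xE eqr_div ?intr_padic_eq0 ?denq_neq0 //.
  by rewrite -!rmorphM qE.
exists (numq q), (denq q); split=> //.
apply/negP => pd; have : in_pnZp 1 ((numq q)%:~R : Qp).
  rewrite -[_%:~R](divfK d0) -xq mulrC -(rmorph_int (@tofrac Zp)).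
  exact: in_pnZpM.
move=> /in_pnZp_intr; rewrite expn1 => pn.
have : (p %| gcdz (numq q) (denq q))%Z by rewrite dvdz_gcd pn.
by rewrite (eqP cop) dvdz1 /= gtn_eqF ?prime_gt1.
Qed.

(** * One step of the algorithms at a nonzero rational *)

Section Ratio.
Variables (a b : int).
Hypotheses (a0 : a != 0) (b_gt0 : 0 < b) (cab : coprimez a b) (pb : ~~ (p %| b)%Z).
Let x : Qp := a%:~R / b%:~R.

Lemma coef_b_ratio : coef_b x = b.
Proof. by rewrite /coef_b minpoly_ratio // !coefE /= mulr1 subr0. Qed.

Lemma coef_c_ratio : coef_c x = - a.
Proof. by rewrite /coef_c minpoly_ratio // !coefE /= mulr0 add0r. Qed.

(** With a = a' p^v and p not dividing a', one has u(x) = -a' and v_p(x) = v, so the numerator is -a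
    and division by a/b cancels a. *)
Lemma u_vp_ratio : (u x)%:~R * p%:R ^ vp x / x = - b%:~R.
Proof.
have [a' pa' aE] := pfactor_int a0.
have uE : u x = - a'.
  by rewrite /u coef_c_ratio abszN {1}aE -mulNr mulzK // expp_neq0.
have vE : vp x = logn p `|a|.
  rewrite -[RHS](vp_unit (logn p `|a|) (z := a'%:~R / b%:~R : Zp)).
    by rewrite -unit_ratio // /x {1}aE rmorphM /= intr_pX mulrCA mulrA.
  by rewrite unitrM unitrV !intr_unit.
rewrite uE vE -exprnP -intr_pX rmorphN mulNr -rmorphM /= -aE mulNr /x invf_div.
by rewrite mulrC divfK // intr_padic_eq0.
Qed.

(** The digit is the remainder of -b modulo p; subtracting it leaves p times the Euclidean
    quotient. *)
Lemma T1_ratio : T1 x = (p%:Z * ((- b) %/ p)%Z)%:~R.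
Proof.
rewrite /T1 /d1 u_vp_ratio -rmorphN digit_intr ?dvdzE ?abszN //.
rewrite -[X in _ - X]/((`|((- b) %% p)%Z|%N : int)%:~R) -rmorphB gez0_abs.
  by rewrite {1}(divz_eq (- b) p) addrK mulrC.
by rewrite modz_ge0 // (expp_neq0 1).
Qed.

Lemma T2_ratio : T2 x = (p%:Z * (b %/ p)%Z)%:~R.
Proof.
rewrite /T2 /d2 !mulNr u_vp_ratio opprK digit_intr //.
rewrite -[X in _ - X]/((`|(b %% p)%Z|%N : int)%:~R) -rmorphB gez0_abs.
  by rewrite {1}(divz_eq b p) addrK mulrC.
by rewrite modz_ge0 // -(expn1 p) expp_neq0.
Qed.

End Ratio.

(** * Integers and termination *)

Lemma p_ndvd1 : ~~ (p %| 1)%Z.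
Proof. by rewrite dvdz1 /= gtn_eqF ?prime_gt1. Qed.

Lemma intr_ratio (a : int) : a%:~R = a%:~R / 1%:~R :> Qp.
Proof. by rewrite divr1. Qed.

Lemma T2_intr (a : int) : a != 0 -> T2 (a%:~R : Qp) = 0.
Proof.
move=> a0; rewrite intr_ratio T2_ratio ?p_ndvd1 //; last by rewrite coprimezE coprimen1.
by rewrite divz_small ?mulr0 // ltz_nat /= prime_gt1.
Qed.

Lemma T1_intr (a : int) : a != 0 -> T1 (a%:~R : Qp) = (- p%:Z)%:~R.
Proof.
move=> a0; rewrite intr_ratio T1_ratio ?p_ndvd1 //; last by rewrite coprimezE coprimen1.
suff -> : ((- 1) %/ p)%Z = -1 by rewrite mulrN1.
have p_gt0 : 0 < p%:Z by rewrite ltz_nat prime_gt0.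
(* Euclidean division has a nonnegative remainder: -1 = (-1) p + (p - 1). *)
have := divzMDl (-1) (p%:Z - 1) (lt0r_neq0 p_gt0).
rewrite mulN1r addKr => ->; rewrite divz_small ?addr0 // subr_ge0 /= -gtz0_ge1 p_gt0.
by rewrite ltrBlDr ltrDl.
Qed.

(** The minimal polynomial X - a has b = 1 and c = -a > 0, so every algorithm selects [T2]. *)
Lemma T_intr_neg (A : algorithm) (a : int) : a < 0 -> T A (a%:~R : Qp) = 0.
Proof.
move=> a_lt0; rewrite /T.
have -> : uses_T2 A (a%:~R : Qp); last by rewrite T2_intr ?lt_eqF.
rewrite intr_ratio; have a1 : coprimez a 1 by rewrite coprimezE coprimen1.
by case: A => //=; rewrite ?coef_b_ratio ?coef_c_ratio ?oppr_gt0.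
Qed.

Lemma iter_T_intr A (a : int) : exists i, iter i (T A) (a%:~R : Qp) = 0.
Proof.
have [->|a0] := eqVneq a 0; first by exists 0%N.
have [T2A|T1A] := boolP (uses_T2 A (a%:~R : Qp)).
  by exists 1%N; rewrite /= /T T2A T2_intr.
(* The first step, by [T1], gives -p; the second gives 0. *)
exists 2%N; rewrite /= {2}/T (negPf T1A) T1_intr // T_intr_neg //.
by rewrite oppr_lt0 ltz_nat prime_gt0.
Qed.

Lemma iter_T_ratio A x : is_ratio x -> in_pnZp 1 x ->
  exists i, iter i (T A) x = 0 :> Qp.
Proof.
move=> xq xp; have [a [b [-> b_gt0 cab pb]]] := in_pZp_ratio xq xp.
have [->|a0] := eqVneq a 0; first by exists 0%N; rewrite mul0r.
have [m TE] : exists m : int, T A (a%:~R / b%:~R : Qp) = m%:~R.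
  by rewrite /T; case: ifP => _; [rewrite T2_ratio | rewrite T1_ratio] => //; eexists.
by have [i iE] := iter_T_intr A m; exists i.+1; rewrite iterSr TE.
Qed.

End PadicRationals.

Theorem theorem9p1 (p : nat) (p_pr : prime p) (alpha : rat) (A : algorithm) :
  cf_finite (cf_expansion A (ratr alpha : padic p_pr)).
Proof.
have alphaq : is_ratio (ratr alpha : padic p_pr).
  by exists (numq alpha), (denq alpha); rewrite denq_neq0.
have [fracq fracp] := padic_frac_ratio alphaq.
have [i iE] := iter_T_ratio A fracq fracp.
(* The term of index i tests the iterates 0 to i; the last of them vanishes. *)
exists i; rewrite /=; case: ifP => // /forallP/(_ ord_max).
by rewrite /= iE eqxx.
Qed.
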